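(* Let $p$ be an odd prime, let $0<\alpha<1$, and let $c>0$ be a constant such that for every non-principal Dirichlet character $\chi$ modulo $p$ and all integers $N\ge 0$ and $1\le H<p$, $$\left|\sum_{m=N+1}^{N+H}\chi(m)\right| \le c\sqrt{p}\,\log p.$$ Let $n=\omega(p-1)$. Let $e$ be an even divisor of $p-1$ and let $p_1,\dots,p_s$ be the primes dividing $p-1$ but not dividing $e$, where $1\le s\le n$. Define $$\delta = 1-\sum_{i=1}^{s}\frac{1}{p_i},\qquad \Delta=\frac{s-1}{\delta}+2,$$ and suppose $\delta>0$. If $$\frac{p^{\alpha-1/2}}{\log p} > c\left(2^{\,n-s}\Delta-1\right),$$ then there is a primitive root $g$ modulo $p$ with $g<p^{\alpha}$.
   Context: $\omega(m)$ denotes the number of distinct prime divisors of a positive integer $m$. A primitive root modulo $p$ is an integer whose residue generates the multiplicative group $(\mathbb{Z}/p\mathbb{Z})^\times$. *)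

(* Defs.v *)
From HB Require Import structures.
From mathcomp Require Import all_boot all_order all_algebra.
From mathcomp Require Import complex.
From mathcomp Require Import reals exp.
Set Implicit Arguments. Unset Strict Implicit. Unset Printing Implicit Defensive.
Import Order.TTheory GRing.Theory Num.Theory.
Local Open Scope ring_scope.
Local Open Scope complex_scope.

Definition dirichlet_char (R : rcfType) (p : nat) (chi : int -> R[i]) : Prop :=
  (forall m n : int, chi (m * n) = chi m * chi n) /\
  (forall m : int, chi (m + p%:Z) = chi m) /\
  (forall m : int, (chi m != 0) = coprimez m p%:Z).

Definition principal_char (R : rcfType) (p : nat) (chi : int -> R[i]) : Prop :=
  forall m : int, coprimez m p%:Z -> chi m = 1.

(* g is a primitive root modulo p (p prime): its residue generates the
   multiplicative group of F_p, i.e. is a primitive (p-1)-th root of unity. *)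
Definition primitive_root_mod (p g : nat) : bool :=
  (p.-1).-primitive_root (g%:R : 'F_p).

(* Main.v *)
(** Let [w] generate [(Z/p)^*] and let [H] be the largest integer below [p^alpha].
    An integer [m = w^k] is a primitive root iff no prime [q | p-1] divides [k],
    and the indicator of [~~ (q %| k)] is [1 - 1/q] minus [1/q] times the sum of
    the non-principal characters of order [q].  Multiplying these expansions and
    bounding each character sum by [B = c sqrt(p) log(p)] estimates the number of
    [m <= H] free of the primes dividing [e], and of these together with one
    [p_i]; combining the estimates, [N >= sum_i N_(p_i e) - (s-1) N_e] is
    positive as soon as [H > B (2^(n-s) Delta - 1)].

    The hypothesis only yields this for [p^alpha <= H + 1] in place of [H].  The
    missing [1] is recovered as follows: [e] is even, so each [p_i] is odd and the
    characters of order [p_i] are even.  Their sum over [1..H] is half their sum over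
    [-H..H], hence at most [B/2], which improves the estimate by at least [B/2];
    and [B >= 2], because the quadratic character takes equal values at two
    consecutive integers in [1..4]. *)

Require Import Defs.
From HB Require Import structures.
From mathcomp Require Import all_boot all_order all_algebra.
From mathcomp Require Import cyclic separable cyclotomic finfield.
From mathcomp Require Import complex ring lra zify.
From mathcomp Require Import reals exp.
Import Order.TTheory GRing.Theory Num.Theory.
Local Open Scope ring_scope.
Local Open Scope complex_scope.

(** * Primitive roots of unity in ['F_p] and in an algebraically closed field *)

Lemma prim_root_Fp_exists (p : nat) : prime p ->
  exists w : 'F_p, (p.-1).-primitive_root w.
Proof.
move=> p_pr; have p_gt1 := prime_gt1 p_pr.
have := @has_prim_root 'F_p p.-1 (enum (predC1 0)).
case/(_ _ _ _ _)/hasP => [||||w _ w_prim]; last by exists w.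
- by rewrite -subn1 subn_gt0.
- apply/allP=> x; rewrite mem_enum unity_rootE /= => x_neq0.
  rewrite -(inj_eq (mulfI x_neq0)) -exprS prednK ?prime_gt0 // mulr1.
  by rewrite -[X in x ^+ X](card_Fp p_pr) expf_card.
- exact: enum_uniq.
- by rewrite -cardE cardC1 card_Fp.
Qed.

Lemma closed_prim_root_exists (C : numClosedFieldType) (n : nat) : (0 < n)%N ->
  exists z : C, n.-primitive_root z.
Proof.
move=> n_gt0; pose q : {poly C} := 'X^n - 1.
have [r Dq] := closed_field_poly_normal q.
move: Dq; rewrite (monicP (monicXnsubC _ n_gt0)) scale1r => Dq.
have := @has_prim_root C n r n_gt0.
case/(_ _ _ _)/hasP => [|||z _ z_prim]; last by exists z.
- by apply/allP=> z; rewrite -root_prod_XsubC -Dq.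
- by rewrite -separable_prod_XsubC -Dq separable_Xn_sub_1 // pnatr_eq0 -lt0n.
- have := size_prod_XsubC r id; rewrite -Dq size_XnsubC // => -[->]; exact: leqnn.
Qed.

(** * Discrete logarithms and the multiplicative characters modulo [p] *)

Section PowerResidueCharacters.

Set Implicit Arguments.
Unset Strict Implicit.

Context (C : numClosedFieldType) (p : nat) (p_pr : prime p).
Context (w : 'F_p) (w_prim : (p.-1).-primitive_root w).
Context (z : C) (z_prim : (p.-1).-primitive_root z).

Definition dlog (x : 'F_p) : nat := index x [seq w ^+ i | i <- iota 0 p.-1].

Lemma dlogK x : x != 0 -> w ^+ dlog x = x.
Proof.
move=> x_neq0; have x_unity : x ^+ p.-1 = 1.
  apply: (mulfI x_neq0); rewrite -exprS prednK ?prime_gt0 // mulr1.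
  by rewrite -[X in x ^+ X](card_Fp p_pr) expf_card.
have [i Dx] := prim_rootP w_prim x_unity.
have x_in : x \in [seq w ^+ i | i <- iota 0 p.-1].
  by rewrite Dx map_f // mem_iota /= ltn_ord.
have lt_d : (dlog x < p.-1)%N.
  by rewrite -[X in (_ < X)%N](size_iota 0) -(size_map (GRing.exp w)) index_mem.
by rewrite -{2}(nth_index 0 x_in) (nth_map 0%N) ?size_iota // nth_iota.
Qed.

(** If the logarithm were not coprime to [p.-1], any prime factor of their gcd would be one of the
    excluded primes. *)
Lemma prim_root_dlog x : x != 0 ->
  all (fun q => ~~ (q %| dlog x)%N) (primes p.-1) -> (p.-1).-primitive_root x.
Proof.
move=> x_neq0 /allP no_q; have p1_gt0 := prim_order_gt0 w_prim.
rewrite -(dlogK x_neq0) (prim_root_exp_coprime _ w_prim) /coprime.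
apply: contraT => gcd_neq1; set d := gcdn _ _ in gcd_neq1.
have d_gt1 : (1 < d)%N by rewrite ltn_neqAle eq_sym gcd_neq1 gcdn_gt0 p1_gt0 orbT.
have q_dvd := pdiv_dvd d.
have /no_q/negP[] : pdiv d \in primes p.-1.
  by rewrite mem_primes pdiv_prime // p1_gt0 (dvdn_trans q_dvd) ?dvdn_gcdr.
exact: dvdn_trans q_dvd (dvdn_gcdl _ _).
Qed.

(** The [a]-th power of the character sending [w] to [z], extended by 0. For a prime [q] dividing
    [p.-1], the indices [j * (p.-1 %/ q)] with [0 < j < q] give the characters of order [q]. *)
Definition dchar (a : nat) (x : 'F_p) : C := if x == 0 then 0 else z ^+ (a * dlog x).

Lemma dchar0 a : dchar a 0 = 0. Proof. by rewrite /dchar eqxx. Qed.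

Lemma dchar_neq0 a x : (dchar a x != 0) = (x != 0).
Proof.
rewrite /dchar; case: (eqVneq x 0) => _; first by rewrite eqxx.
rewrite expf_neq0 //; apply/eqP => z0.
have := prim_expr_order z_prim; rewrite z0 expr0n.
by rewrite gtn_eqF ?(prim_order_gt0 z_prim) // => /esym/eqP; rewrite oner_eq0.
Qed.

Lemma dchar_exp a k : dchar a (w ^+ k) = z ^+ (a * k).
Proof.
have w_neq0 : w != 0.
  apply/eqP => w0; have := prim_expr_order w_prim; rewrite w0 expr0n.
  by rewrite gtn_eqF ?(prim_order_gt0 z_prim) // => /esym/eqP; rewrite oner_eq0.
rewrite /dchar expf_eq0 (negPf w_neq0) andbF !(mulnC a) !exprM; congr (_ ^+ _).
(* Logarithms are determined only modulo [p.-1], which is also the order of [z]. *)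
apply/eqP; rewrite (eq_prim_root_expr z_prim) -(eq_prim_root_expr w_prim).
by rewrite dlogK // expf_neq0.
Qed.

Lemma dcharM a x y : dchar a (x * y) = dchar a x * dchar a y.
Proof.
have [->|x0] := eqVneq x 0; first by rewrite mul0r dchar0 mul0r.
have [->|y0] := eqVneq y 0; first by rewrite mulr0 dchar0 mulr0.
by rewrite -(dlogK x0) -(dlogK y0) -exprD !dchar_exp mulnDr exprD.
Qed.

Lemma dchar1 a : dchar a 1 = 1.
Proof. by rewrite -(expr0 w) dchar_exp muln0. Qed.

Lemma dcharX a x k : dchar a (x ^+ k) = dchar a x ^+ k.
Proof. by elim: k => [|k IHk]; rewrite ?expr0 ?dchar1 // !exprS dcharM IHk. Qed.

Lemma dcharD a b x : dchar (a + b) x = dchar a x * dchar b x.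
Proof. by rewrite /dchar; case: eqP; rewrite ?mul0r // mulnDl exprD. Qed.

Lemma dchar_trivial x : x != 0 -> dchar 0 x = 1.
Proof. by move=> x0; rewrite /dchar (negPf x0) mul0n. Qed.

Lemma dchar_gen a : (dchar a w == 1) = (p.-1 %| a)%N.
Proof. by rewrite -(expr1 w) dchar_exp muln1 (prim_order_dvd z_prim). Qed.

Lemma dchar_expr_order a k x : (p.-1 %| a * k)%N -> x != 0 -> dchar a x ^+ k = 1.
Proof.
move=> dvd x0; rewrite /dchar (negPf x0) -exprM mulnAC mulnC; apply/eqP.
by rewrite -(prim_order_dvd z_prim) dvdn_mull.
Qed.

(** The value at -1 has square 1 and odd power [q] equal to 1. *)
Lemma dchar_even a q : odd q -> (p.-1 %| a * q)%N -> dchar a (-1) = 1.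
Proof.
move=> q_odd dvd; have x0 : (-1 : 'F_p) != 0 by rewrite oppr_eq0 oner_eq0.
have := dchar_expr_order dvd x0; rewrite -(odd_double_half q) q_odd exprS.
by rewrite -muln2 mulnC exprM -dcharX sqrrN expr1n dchar1 expr1n mulr1.
Qed.

(** Multiplication by [w] permutes ['F_p] and scales the sum by a factor different from 1. *)
Lemma sum_dchar a : ~~ (p.-1 %| a)%N -> \sum_x dchar a x = 0.
Proof.
move=> nontriv; have w_neq0 : w != 0 by rewrite -(dchar_neq0 0) -(expr1 w) dchar_exp oner_eq0.
have : dchar a w * \sum_x dchar a x = \sum_x dchar a x.
  rewrite mulr_sumr [RHS](reindex_inj (mulfI w_neq0)).
  by apply: eq_bigr => x _; rewrite dcharM.
move/eqP; rewrite -subr_eq0 -{2}[\sum_x _]mul1r -mulrBl mulf_eq0 subr_eq0.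
by rewrite dchar_gen (negPf nontriv) => /eqP.
Qed.

Lemma natr_addFp m : (m + p)%:R = m%:R :> 'F_p.
Proof. by rewrite natrD pchar_Fp_0 // addr0. Qed.

Lemma sum_dchar_period a N : ~~ (p.-1 %| a)%N ->
  \sum_(N <= m < N + p) dchar a m%:R = 0.
Proof.
move=> nontriv; have p_gt0 := prime_gt0 p_pr; elim: N => [|N IHN].
  rewrite add0n -[X in index_iota _ X](Fp_cast p_pr) big_mkord.
  rewrite -[RHS](sum_dchar nontriv).
  by apply: eq_bigr => x _; rewrite natr_Zp.
move: IHN; rewrite big_ltn; last by rewrite -addn1 leq_add2l.
rewrite addSn big_nat_recr /=; last by rewrite -addn1 leq_add2l.
by rewrite natr_addFp addrC.
Qed.

(** The value [y] of a character of order [q] is a [q]-th root of unity, equal to 1 exactly when [q]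
    divides the logarithm; the full geometric sum of its powers is thus [q] or 0. *)
Lemma dlog_indicator q x : prime q -> (q %| p.-1)%N -> x != 0 ->
  (~~ (q %| dlog x)%N)%:R =
  1 - q%:R^-1 - q%:R^-1 * \sum_(1 <= j < q) dchar (j * (p.-1 %/ q)) x :> C.
Proof.
move=> q_pr q_dvd x0; have q_gt0 := prime_gt0 q_pr.
have p1_gt0 := prim_order_gt0 w_prim.
have q0 : q%:R != 0 :> C by rewrite pnatr_eq0 -lt0n.
pose y := dchar (p.-1 %/ q) x.
have -> : \sum_(1 <= j < q) dchar (j * (p.-1 %/ q)) x = \sum_(j < q) y ^+ j - 1.
  rewrite -(big_mkord xpredT (fun j => y ^+ j)) big_ltn // expr0 [1 + _]addrC addrK.
  by apply: eq_bigr => j _; rewrite /y /dchar (negPf x0) -exprM -mulnA mulnC.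
have Dy : (y == 1) = (q %| dlog x)%N.
  rewrite /y /dchar (negPf x0) -(prim_order_dvd z_prim) -{1}(divnK q_dvd).
  by rewrite dvdn_pmul2l // divn_gt0 // dvdn_leq.
have yq : y ^+ q = 1 by rewrite dchar_expr_order // divnK.
rewrite -Dy; have [->|y1] := eqVneq y 1.
  under eq_bigr do rewrite expr1n.
  by rewrite sumr_const card_ord /=; field.
have -> : \sum_(j < q) y ^+ j = 0.
  apply/eqP; have := subrX1 y q; rewrite yq subrr => /esym/eqP.
  by rewrite mulf_eq0 subr_eq0 (negPf y1).
by rewrite /=; field.
Qed.

Lemma natr_Fp_neq0 m : (0 < m < p)%N -> m%:R != 0 :> 'F_p.
Proof.
case/andP=> m_gt0 m_lt; rewrite -(dvdn_pcharf (pchar_Fp p_pr)).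
by rewrite gtnNdvd.
Qed.

(** * Character sums over sieved sets *)

Definition free_of (qs : seq nat) (x : 'F_p) : bool :=
  all (fun q => ~~ (q %| dlog x)%N) qs.

Definition free_density (qs : seq nat) : C := \prod_(q <- qs) (1 - q%:R^-1).

(** The twist is built in because expanding the indicator of one prime creates twisted sums; for
    [H < p], [a = 0] gives the plain count. *)
Definition free_sum (H a : nat) (qs : seq nat) : C :=
  \sum_(1 <= m < H.+1) dchar a m%:R * (free_of qs m%:R)%:R.

Definition sieving_primes (qs : seq nat) : bool :=
  all (fun q => prime q && (q %| p.-1)%N) qs.

Lemma free_density_gt0 qs : sieving_primes qs -> 0 < free_density qs.
Proof.
rewrite /free_density; elim: qs => [|q qs IHqs] /=; first by rewrite big_nil ltr01.
case/andP=> /andP[q_pr _] /IHqs pos; rewrite big_cons mulr_gt0 // subr_gt0.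
by rewrite invf_lt1 ?ltr1n ?ltr0n ?prime_gt1 ?prime_gt0.
Qed.

Lemma free_sum_nil H a : free_sum H a [::] = \sum_(1 <= m < H.+1) dchar a m%:R.
Proof. by apply: eq_bigr => m _; rewrite mulr1. Qed.

Lemma free_sum_cons H a q qs : (H < p)%N -> prime q -> (q %| p.-1)%N ->
  free_sum H a (q :: qs) = (1 - q%:R^-1) * free_sum H a qs -
    q%:R^-1 * \sum_(1 <= j < q) free_sum H (a + j * (p.-1 %/ q)) qs.
Proof.
move=> ltHp q_pr q_dvd; rewrite /free_sum exchange_big /= !mulr_sumr -sumrB.
apply: eq_big_nat => m /andP[m_gt0 m_le]; have x0 : m%:R != 0 :> 'F_p.
  by rewrite natr_Fp_neq0 // m_gt0 (leq_trans m_le).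
rewrite -mulnb natrM dlog_indicator // -mulr_suml.
under [in RHS]eq_bigr do rewrite dcharD.
by rewrite -mulr_sumr; ring.
Qed.

(** * Sieve estimates from a bound on complete families of character sums *)

Section CharacterSumBound.

Context (B : C) (H : nat) (ltHp : (H < p)%N).
Context (sum_le : forall a, ~~ (p.-1 %| a)%N -> `|free_sum H a [::]| <= B).

(* The discount [eps] survives the sieve: only the untwisted term of the
   expansion of [free_sum] carries it. *)
Lemma norm_free_sum_le eps a qs : sieving_primes qs ->
  ~~ (p.-1 %| a * \prod_(q <- qs) q)%N -> `|free_sum H a [::]| <= B - eps ->
  `|free_sum H a qs| <= free_density qs * (2 ^+ size qs * B - eps).
Proof.
rewrite /free_density.
elim: qs eps a => [|q qs IHqs] eps a /=; first by rewrite !big_nil expr0 !mul1r.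
case/andP=> /andP[q_pr q_dvd] qsP; rewrite !big_cons => ndvd le_eps.
have q_gt0 := prime_gt0 q_pr; have Vq_ge0 : 0 <= q%:R^-1 :> C by rewrite invr_ge0 ler0n.
have ndvd_a : ~~ (p.-1 %| a * \prod_(q <- qs) q)%N.
  by apply: contra ndvd => /(dvdn_mull q); rewrite mulnCA.
(* The order of [dchar a] does not divide the product of all the primes; multiplying by a character
   of order dividing [q] cannot make it divide the product of the others. *)
have ndvd_j j : ~~ (p.-1 %| (a + j * (p.-1 %/ q)) * \prod_(q <- qs) q)%N.
  apply: contra ndvd => /(dvdn_mulr q).
  set P := (\prod_(_ <- _) _)%N; rewrite mulnDl mulnDl.
  have -> : (j * (p.-1 %/ q) * P * q = p.-1 * (j * P))%N.
    by rewrite -{2}(divnK q_dvd); ring.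
  by rewrite (dvdn_addl _ (dvdn_mulr _ (dvdnn _))) -mulnA [(P * q)%N]mulnC.
have nontriv j : ~~ (p.-1 %| a + j * (p.-1 %/ q))%N.
  by apply: contra (ndvd_j j); apply: dvdn_mulr.
rewrite free_sum_cons //; apply: le_trans (ler_normB _ _) _.
rewrite !normrM (ger0_norm Vq_ge0).
have dens_ge0 : 0 <= 1 - q%:R^-1 :> C.
  by rewrite subr_ge0 invf_le1 ?ler1n ?ltr0n.
rewrite (ger0_norm dens_ge0); set D := \prod_(_ <- _) _.
(* The [q - 1] twisted terms, weighted by 1/q, again total [1 - q%:R^-1]; this doubles the
   coefficient of [B] and leaves that of [eps] alone. *)
apply: (@le_trans _ _ ((1 - q%:R^-1) * (D * (2 ^+ size qs * B - eps)) +
   q%:R^-1 * ((q%:R - 1) * (D * (2 ^+ size qs * B))))).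
  apply: lerD; first by rewrite ler_wpM2l // IHqs.
  rewrite ler_wpM2l //; apply: le_trans (ler_norm_sum _ _ _) _.
  have -> : q%:R - 1 = (q - 1)%:R :> C by rewrite natrB.
  rewrite mulr_natl -sumr_const_nat; apply: ler_sum_nat => j _.
  by rewrite -[_ * B]subr0; apply: IHqs; rewrite ?subr0 ?sum_le.
rewrite exprS le_eqVlt; apply/orP; left; apply/eqP; field.
by rewrite pnatr_eq0 -lt0n.
Qed.

(** The twisting character has order exactly [q], which does not divide the product of the other
    primes [qs]. *)
Lemma norm_free_sum_twist q j qs eps : prime q -> (q %| p.-1)%N ->
  sieving_primes qs -> q \notin qs -> (0 < j < q)%N ->
  `|free_sum H (j * (p.-1 %/ q)) [::]| <= B - eps ->
  `|free_sum H (j * (p.-1 %/ q)) qs| <= free_density qs * (2 ^+ size qs * B - eps).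
Proof.
move=> q_pr q_dvd qsP q_notin /andP[j_gt0 ltjq]; apply: norm_free_sum_le => //.
have p1_gt0 := prim_order_gt0 w_prim.
have M_gt0 : (0 < p.-1 %/ q)%N by rewrite divn_gt0 ?prime_gt0 // dvdn_leq.
rewrite -{1}(divnK q_dvd) mulnAC [(_ * (p.-1 %/ q))%N]mulnC dvdn_pmul2l //.
rewrite Euclid_dvdM // (gtnNdvd j_gt0 ltjq) /=.
elim: qs qsP q_notin => [|r qs IHqs] /=; first by rewrite big_nil dvdn1 gtn_eqF ?prime_gt1.
case/andP=> /andP[r_pr _] qsP; rewrite inE negb_or big_cons => /andP[neq_qr q_notin].
by rewrite Euclid_dvdM // dvdn_prime2 // negb_or neq_qr IHqs.
Qed.

Lemma free_count_nil : free_sum H 0 [::] = H%:R.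
Proof.
rewrite free_sum_nil (eq_big_nat _ _ (F2 := fun=> 1)) => [|m /andP[m_gt0 m_le]].
  by rewrite sumr_const_nat subn1.
by rewrite dchar_trivial // natr_Fp_neq0 // m_gt0 (leq_trans m_le).
Qed.

Lemma free_countE qs :
  free_sum H 0 qs = (\sum_(1 <= m < H.+1) free_of qs m%:R)%:R.
Proof.
rewrite natr_sum; apply: eq_big_nat => m /andP[m_gt0 m_le].
by rewrite dchar_trivial ?mul1r // natr_Fp_neq0 // m_gt0 (leq_trans m_le).
Qed.

(** The difference consists only of twists of order [q], so a saving [eps] for these characters is
    enough. *)
Lemma norm_free_count_cons q qs eps : prime q -> (q %| p.-1)%N ->
  sieving_primes qs -> q \notin qs ->
  (forall j, (0 < j < q)%N -> `|free_sum H (j * (p.-1 %/ q)) [::]| <= B - eps) ->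
  `|free_sum H 0 (q :: qs) - (1 - q%:R^-1) * free_sum H 0 qs| <=
    (1 - q%:R^-1) * (free_density qs * (2 ^+ size qs * B - eps)).
Proof.
move=> q_pr q_dvd qsP q_notin le_eps; have q_gt0 := prime_gt0 q_pr.
have Vq_ge0 : 0 <= q%:R^-1 :> C by rewrite invr_ge0 ler0n.
rewrite free_sum_cons // addrC addKr normrN normrM (ger0_norm Vq_ge0).
set K := _ * (_ - eps).
have -> : (1 - q%:R^-1) * K = q%:R^-1 * ((q%:R - 1) * K).
  by field; rewrite pnatr_eq0 -lt0n.
rewrite ler_wpM2l //; apply: le_trans (ler_norm_sum _ _ _) _.
have -> : q%:R - 1 = (q - 1)%:R :> C by rewrite natrB.
rewrite mulr_natl -sumr_const_nat; apply: ler_sum_nat => j j_in.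
by apply: norm_free_sum_twist => //; apply: le_eps.
Qed.

Lemma nontrivial_twist q j : prime q -> (q %| p.-1)%N -> (0 < j < q)%N ->
  ~~ (p.-1 %| j * (p.-1 %/ q))%N.
Proof.
move=> q_pr q_dvd /andP[j_gt0 ltjq]; have p1_gt0 := prim_order_gt0 w_prim.
rewrite -{1}(divnK q_dvd) [(j * _)%N]mulnC dvdn_pmul2l; first by rewrite gtnNdvd.
by rewrite divn_gt0 ?prime_gt0 // dvdn_leq.
Qed.

(** Relative to the density, the successive primes contribute errors [B], [2B], [4B] and so on, a
    geometric sum. *)
Lemma norm_free_count_sub qs : sieving_primes qs -> uniq qs ->
  `|free_sum H 0 qs - free_density qs * H%:R| <=
    free_density qs * ((2 ^+ size qs - 1) * B).
Proof.
elim: qs => [|q qs IHqs] /=.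
  by rewrite free_count_nil /free_density big_nil expr0 !mul1r !subrr normr0 mul0r.
case/andP=> /andP[q_pr q_dvd] qsP /andP[q_notin qs_uniq].
have dens_ge0 : 0 <= 1 - q%:R^-1 :> C.
  by rewrite subr_ge0 invf_le1 ?ler1n ?ltr0n ?prime_gt0.
have := @norm_free_count_cons q qs 0 q_pr q_dvd qsP q_notin.
rewrite !subr0 => /(_ (fun j j_in => sum_le (nontrivial_twist q_pr q_dvd j_in))).
have := ler_wpM2l dens_ge0 (IHqs qsP qs_uniq).
rewrite -[X in X * `|_| <= _](ger0_norm dens_ge0) -normrM => le1 le2.
have := le_trans (ler_normD _ _) (lerD le1 le2).
rewrite /free_density !big_cons; set D := \prod_(_ <- _) _; congr (`|_| <= _).
  by ring.
by rewrite exprS; ring.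
Qed.

(* Without a primitive root up to [H], each [m] free of [es] is counted for at most
   [size ps - 1] of the [q] in [ps]. *)
Lemma sieve_count es ps : primes p.-1 =i es ++ ps ->
  (forall m, (0 < m <= H)%N -> ~~ (p.-1).-primitive_root (m%:R : 'F_p)) ->
  \sum_(q <- ps) free_sum H 0 (q :: es) <= ((size ps)%:R - 1) * free_sum H 0 es.
Proof.
move=> esps noprim; rewrite mulrBl mul1r lerBrDr.
under eq_bigr do rewrite free_countE.
rewrite free_countE -natr_sum -natrD -natrM ler_nat exchange_big /= -big_split /=.
rewrite big_distrr /= big_nat [X in (_ <= X)%N]big_nat.
apply: leq_sum => m /andP[m_gt0 m_le].
have x0 : m%:R != 0 :> 'F_p by rewrite natr_Fp_neq0 // m_gt0 (leq_trans m_le).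
have := noprim m; rewrite m_gt0 -ltnS m_le => /(_ isT).
have /implyP := prim_root_dlog x0; rewrite (eq_all_r esps) all_cat.
rewrite -[all _ es]/(free_of es _); case: (free_of es _) => /=; last first.
  by move=> _ _; rewrite big1 ?muln0 // => q _; rewrite andbF.
case: (boolP (all _ ps)) => [_ /= -> //|/allPn[q0 q0_in q0_dvd] _ _].
under eq_bigr do rewrite andbT.
rewrite muln1 (_ : \sum_(q <- ps) _ = count (fun q => ~~ (q %| dlog m%:R)%N) ps)%N.
  rewrite -(count_predC (fun q => ~~ (q %| dlog m%:R)%N) ps) leq_add2l -has_count.
  by apply/hasP; exists q0.
by rewrite -sum1_count [RHS]big_mkcond; apply: eq_bigr => q _; case: (_ %| _)%N.
Qed.

(** Summing the lower bounds for the counts of [q :: es] against [sieve_count] leaves [delta * N <=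
    (size ps - 1 + delta) * D * K]; the lower bound for [N] then limits [H]. *)
Lemma sieve_inequality eps es ps : primes p.-1 =i es ++ ps -> uniq (es ++ ps) ->
  (forall q j, q \in ps -> (0 < j < q)%N ->
    `|free_sum H (j * (p.-1 %/ q)) [::]| <= B - eps) ->
  (forall m, (0 < m <= H)%N -> ~~ (p.-1).-primitive_root (m%:R : 'F_p)) ->
  let delta := 1 - \sum_(q <- ps) q%:R^-1 in 0 < delta ->
  delta * (H%:R - (2 ^+ size es - 1) * B) <=
    ((size ps)%:R - 1 + delta) * (2 ^+ size es * B - eps).
Proof.
move=> esps; rewrite cat_uniq => /and3P[es_uniq disj ps_uniq] le_eps noprim delta delta_gt0.
have primeP q : q \in es ++ ps -> prime q && (q %| p.-1)%N.
  by rewrite -esps mem_primes => /and3P[-> _ ->].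
have esP : sieving_primes es.
  by apply/allP => q q_in; apply: primeP; rewrite mem_cat q_in.
have D_gt0 := free_density_gt0 esP.
set K := 2 ^+ size es * B - eps; set D := free_density es in D_gt0.
set N := free_sum H 0 es.
have N_real : N \is Num.real by rewrite /N free_countE realn.
have sumD : \sum_(q <- ps) (1 - q%:R^-1) = (size ps)%:R - 1 + delta :> C.
  by rewrite sumrB /delta big_const_seq count_predT iter_addr_0; ring.
have le_sieve : ((size ps)%:R - 1 + delta) * (N - D * K) <= ((size ps)%:R - 1) * N.
  apply: le_trans (sieve_count esps noprim).
  rewrite -sumD mulr_suml big_seq [X in _ <= X]big_seq; apply: ler_sum => q q_in.
  have /andP[q_pr q_dvd] : prime q && (q %| p.-1)%N by rewrite primeP // mem_cat q_in orbT.
  have q_notin : q \notin es by apply: contra disj => q_es; apply/hasP; exists q.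
  have := norm_free_count_cons q_pr q_dvd esP q_notin (fun j => le_eps q j q_in).
  rewrite real_ler_norml; last first.
    apply: rpredB; first by rewrite free_countE realn.
    by apply: rpredM => //; apply: rpredB; rewrite ?real1 // rpredV realn.
  by rewrite lerBrDl => /andP[le_q _]; rewrite mulrBr.
have N_ge : D * (H%:R - (2 ^+ size es - 1) * B) <= N.
  have := norm_free_count_sub esP es_uniq.
  rewrite real_ler_norml; last first.
    by apply: rpredB => //; apply: rpredM; rewrite ?realn ?gtr0_real.
  by rewrite lerBrDl => /andP[le_N _]; rewrite mulrBr.
rewrite -(ler_pM2l D_gt0) mulrCA.
apply: le_trans (ler_wpM2l (ltW delta_gt0) N_ge) _.
move: le_sieve; rewrite mulrBr lerBlDr [(_ - 1 + delta) * N]mulrDl -lerBlDl.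
by rewrite addrC addKr mulrCA.
Qed.

End CharacterSumBound.

(** * Even characters and the size of the bound [B] *)

Section ShortIntervalSums.

Context (B : C).
Context (interval_sum_le : forall a, ~~ (p.-1 %| a)%N ->
  forall N L : nat, (1 <= L)%N -> (L < p)%N ->
  `|\sum_(N.+1 <= m < N + L + 1) dchar a m%:R| <= B).

Lemma norm_free_sum_nil_le a H : (0 < H < p)%N -> ~~ (p.-1 %| a)%N ->
  `|free_sum H a [::]| <= B.
Proof.
case/andP=> H_gt0 ltHp /interval_sum_le/(_ 0%N H H_gt0 ltHp).
by rewrite free_sum_nil add0n addn1.
Qed.

(** The interval from [-H] to [H] is shifted by [p] to stay in [nat]; its middle term vanishes. *)
Lemma sum_dchar_symmetric a H : (H < p)%N -> dchar a (-1) = 1 ->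
  \sum_(p - H <= m < p + H.+1) dchar a m%:R = free_sum H a [::] *+ 2.
Proof.
move=> + even; rewrite free_sum_nil; elim: H => [_|H IHH ltHp].
  by rewrite subn0 addn1 big_nat1 pchar_Fp_0 // dchar0 big_geq // mul0rn.
rewrite addnS big_nat_recr /=; last by lia.
have -> : (p - H.+1 = (p - H).-1)%N by lia.
rewrite big_ltn; last by lia.
rewrite prednK ?subn_gt0 ?(ltnW ltHp) // IHH ?(ltnW ltHp) //.
rewrite [in RHS]big_nat_recr //= mulrnDl [X in _ = _ + X]mulr2n.
have -> : dchar a (p + H.+1)%:R = dchar a H.+1%:R by rewrite addnC natr_addFp.
have -> : dchar a (p - H).-1%:R = dchar a H.+1%:R.
  have -> : ((p - H).-1 = p - H.+1)%N by lia.
  by rewrite natrB ?(ltnW ltHp) // pchar_Fp_0 // sub0r -mulN1r dcharM even mul1r.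
by rewrite addrAC addrC.
Qed.

(* An even character has the same sum over [-H, -1] and [1, H], and the interval
   [-H, H] is, up to a full period, an interval to which the bound applies. *)
Lemma norm_even_sum_le a H : (H < p)%N -> ~~ (p.-1 %| a)%N ->
  dchar a (-1) = 1 -> `|free_sum H a [::]| <= B - B / 2.
Proof.
move=> ltHp nontriv even; have p_gt1 := prime_gt1 p_pr.
have B_ge0 : 0 <= B by apply: le_trans (interval_sum_le nontriv 0 (leqnn 1) p_gt1).
suff: `|free_sum H a [::] *+ 2| <= B.
  rewrite normrMn -[X in X <= _]mulr_natr -ler_pdivlMr ?ltr0n // => le_half.
  by rewrite [X in X - _](splitr B) addrK.
rewrite -sum_dchar_symmetric //.
have [short|long] := ltnP (2 * H + 1) p.
  have := interval_sum_le nontriv (p - H.+1)%N (ltn_addl _ (ltn0Sn 0)) short.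
  have -> : ((p - H.+1).+1 = p - H)%N by lia.
  have -> : (p - H.+1 + (2 * H + 1) + 1 = p + H.+1)%N by lia.
  exact.
rewrite (big_cat_nat (n := (p - H + p)%N)) /=; [|lia|lia].
rewrite sum_dchar_period // add0r.
(* If [2 * H + 1 = p] nothing is left after the period, and the assumed bound covers only nonempty
   intervals. *)
have [L0|L_gt0] := posnP (2 * H + 1 - p)%N; first by rewrite big_geq ?normr0 //; lia.
have := interval_sum_le nontriv (p - H.+1 + p)%N L_gt0.
have -> : ((p - H.+1 + p).+1 = p - H + p)%N by lia.
have -> : (p - H.+1 + p + (2 * H + 1 - p) + 1 = p + H.+1)%N by lia.
by apply; lia.
Qed.

(* Among [1, 2, 3, 4] two neighbours have the same quadratic character. *)
Lemma interval_bound_ge2 : odd p -> (4 < p)%N -> 2 <= B.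
Proof.
move=> p_odd p_gt4; pose f m := dchar p.-1./2 m%:R.
have Dp : (p.-1./2 * 2 = p.-1)%N by lia.
have nontriv : ~~ (p.-1 %| p.-1./2)%N by rewrite gtnNdvd //; lia.
have sum2 N : `|f N.+1 + f N.+2| <= B.
  have := interval_sum_le nontriv N (isT : 1 <= 2)%N (leq_trans _ p_gt4) => /(_ isT).
  by rewrite addn2 addn1 big_nat_recr //= big_nat1.
have f_sign m : (0 < m < p)%N -> f m = 1 \/ f m = -1.
  move=> m_in; have := dchar_expr_order (_ : p.-1 %| p.-1./2 * 2)%N (natr_Fp_neq0 m_in).
  by rewrite Dp dvdnn => /(_ isT)/eqP; rewrite sqrf_eq1 => /orP[]/eqP; [left|right].
have f1 : f 1%N = 1 by rewrite /f dchar1.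
(* As [f 4] is the square of [f 2], the equal neighbours are 1, 2 if [f 2 = 1], else 3, 4 if
   [f 3 = 1], else 2, 3. *)
have f4 : f 4%N = 1.
  rewrite /f (natrM _ 2 2) dcharM -/(f 2%N).
  by have [|->|->] := f_sign 2%N; [lia | rewrite mulr1 | rewrite mulrNN mulr1].
have [|f2|f2] := f_sign 2%N; first by lia.
  by have := sum2 0%N; rewrite f1 f2 -[1 + 1]/(2%:R) normr_nat.
have [|f3|f3] := f_sign 3%N; first by lia.
  by have := sum2 2%N; rewrite f3 f4 -[1 + 1]/(2%:R) normr_nat.
by have := sum2 1%N; rewrite f2 f3 -opprD normrN -[1 + 1]/(2%:R) normr_nat.
Qed.

End ShortIntervalSums.

End PowerResidueCharacters.

(** * The characters as Dirichlet characters on the integers *)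

Lemma intr_Fp_neq0 (p : nat) (m : int) : prime p ->
  (m%:~R != 0 :> 'F_p) = coprimez m p%:Z.
Proof.
move=> p_pr; rewrite /coprimez /gcdz eqz_nat -/(coprime _ _) coprime_sym prime_coprime //.
rewrite (dvdn_pcharf (pchar_Fp p_pr)); congr (~~ _).
case: m => n /=; first by rewrite -pmulrn.
by rewrite NegzE mulrNz oppr_eq0 -pmulrn.
Qed.

Section PowerResidueDirichletCharacters.

Set Implicit Arguments.
Unset Strict Implicit.

Context (R : rcfType) (p : nat) (p_pr : prime p).
Context (w : 'F_p) (w_prim : (p.-1).-primitive_root w).
Context (z : R[i]) (z_prim : (p.-1).-primitive_root z).

Lemma dchar_dirichlet a : dirichlet_char p (fun m : int => dchar w z a m%:~R).
Proof.
split=> [m n|]; first by rewrite intrM (dcharM p_pr w_prim z_prim).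
split=> m; first by rewrite intrD -pmulrn pchar_Fp_0 // addr0.
by rewrite (dchar_neq0 w z_prim) intr_Fp_neq0.
Qed.

Lemma dchar_nonprincipal a : ~~ (p.-1 %| a)%N ->
  ~ principal_char p (fun m : int => dchar w z a m%:~R).
Proof.
rewrite -(dchar_gen p_pr w_prim z_prim) => /eqP nontriv principal; apply: nontriv.
have Dw : ((w : nat)%:Z)%:~R = w by rewrite -pmulrn natr_Zp.
(* An integer representing [w] is a witness: the value there is not 1. *)
rewrite -{2}Dw; apply: principal; rewrite -intr_Fp_neq0 // Dw.
by rewrite -(dchar_neq0 w z_prim 0) -(expr1 w) (dchar_exp p_pr w_prim z_prim) mul0n oner_eq0.
Qed.

End PowerResidueDirichletCharacters.

Theorem theorem3 (R : realType) (p : nat) (alpha c : R) (e : nat) :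
  prime p -> odd p ->
  0 < alpha < 1 -> 0 < c ->
  (forall chi : int -> R[i], dirichlet_char p chi -> ~ principal_char p chi ->
     forall N H : nat, (1 <= H)%N -> (H < p)%N ->
       `|\sum_(N.+1 <= m < N + H + 1) chi m%:Z|
         <= (c * Num.sqrt (p%:R) * ln (p%:R))%:C) ->
  let n := size (primes p.-1) in
  ~~ odd e -> (e %| p.-1)%N ->
  let ps := [seq q <- primes p.-1 | ~~ (q %| e)%N] in
  let s := size ps in
  (1 <= s)%N ->
  let delta : R := 1 - \sum_(q <- ps) (q%:R)^-1 in
  let Delta : R := (s%:R - 1) / delta + 2 in
  0 < delta ->
  (p%:R) `^ (alpha - 2^-1) / ln (p%:R) > c * (2 ^+ (n - s) * Delta - 1) ->
  exists g : nat, (0 < g)%N /\ primitive_root_mod p g /\ g%:R < (p%:R) `^ alpha.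
Proof.
move=> p_pr p_odd /andP[alpha_gt0 alpha_lt1] c_gt0 chi_le n e_even e_dvd ps s s_gt0
  delta Delta delta_gt0 large.
have p_gt1 := prime_gt1 p_pr; have p1_gt0 : (0 < p.-1)%N by rewrite -subn1 subn_gt0.
have [w w_prim] := prim_root_Fp_exists _ p_pr.
have [z z_prim] := closed_prim_root_exists R[i] _ p1_gt0.
pose b : R := c * Num.sqrt p%:R * ln p%:R; pose es := [seq q <- primes p.-1 | (q %| e)%N].
have esps : perm_eq (primes p.-1) (es ++ ps) by rewrite perm_sym perm_filterC.
have size_es : (n - s)%N = size es by rewrite /n (perm_size esps) size_cat addnK.
have psP q : q \in ps -> [/\ prime q, (q %| p.-1)%N & odd q].
  rewrite mem_filter mem_primes => /andP[q_ndvd /and3P[q_pr _ q_dvd]]; split=> //.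
  (* Since [e] is even, 2 is not among the [ps]. *)
  by case: (even_prime q_pr) => // q2; rewrite q2 dvdn2 e_even in q_ndvd.
have p_gt4 : (4 < p)%N.
  have: (0 < size ps)%N by []; rewrite -has_predT => /hasP[q /psP[q_pr q_dvd q_odd] _].
  have q_gt2 : (2 < q)%N by apply: odd_prime_gt2.
  rewrite ltn_neqAle; apply/andP; split; first by apply/eqP => p4; rewrite -p4 in p_odd.
  by have := leq_trans q_gt2 (dvdn_leq p1_gt0 q_dvd); rewrite -ltnS prednK ?prime_gt0.
have sum_le a : ~~ (p.-1 %| a)%N -> forall N L : nat, (1 <= L)%N -> (L < p)%N ->
    `|\sum_(N.+1 <= m < N + L + 1) dchar w z a m%:R| <= b%:C.
  move=> nontriv; exact: chi_le (dchar_dirichlet p_pr w_prim z_prim a)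
    (dchar_nonprincipal p_pr w_prim z_prim nontriv).
have b_ge2 : 2 <= b.
  have := interval_bound_ge2 p_pr w_prim z_prim sum_le p_odd p_gt4.
  by rewrite -(rmorph_nat (real_complex R)) lecR.
have p_gt1R : 1 < p%:R :> R by rewrite ltr1n.
(* The hypothesis multiplied by [sqrt(p) * ln(p)]. *)
have X_gt : b * (2 ^+ (n - s) * Delta - 1) < p%:R `^ alpha.
  have ln_p := ln_gt0 p_gt1R.
  have sqrt_p : 0 < Num.sqrt (p%:R : R) by rewrite sqrtr_gt0 (lt_trans ltr01).
  have := large; rewrite ltr_pdivlMr // -(ltr_pM2l sqrt_p) => large'.
  rewrite -[alpha](subrK 2^-1) powRD ?powR12_sqrt ?ler0n //; last first.
    by apply/implyP => _; rewrite pnatr_eq0 -lt0n prime_gt0.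
  by rewrite [ltRHS]mulrC; apply: le_lt_trans large'; rewrite /b; lra.
(* [H] is the ceiling of [p^alpha] minus 1, so that the inequality below [p^alpha] is strict. *)
have [H ltHX leXH] : exists2 H : nat, H%:R < p%:R `^ alpha & p%:R `^ alpha <= H.+1%:R.
  have := ceil_itv (p%:R `^ alpha : R).
  have : 0 < Num.ceil (p%:R `^ alpha : R) by rewrite ceil_gt0 powR_gt0 ?ltr0n ?prime_gt0.
  case: (Num.ceil _) => [[//|H] _|//] /andP[ltHX leXH]; exists H => //.
  by apply: le_lt_trans ltHX; rewrite intrD mulrN1z -pmulrn -addn1 natrD addrK.
have ltHp : (H < p)%N.
  rewrite -(ltr_nat R); apply: lt_le_trans ltHX _.
  by rewrite ler1_powR ?ltW.
have [g /andP[g_gt0 g_prim]|no_g] :=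
  pickP (fun g : 'I_H.+1 => (0 < g)%N && primitive_root_mod p g).
  by exists g; split=> //; split=> //; apply: le_lt_trans ltHX; rewrite ler_nat -ltnS.
have noprim m : (0 < m <= H)%N -> ~~ (p.-1).-primitive_root (m%:R : 'F_p).
  case/andP=> m_gt0 m_le; have := no_g (Ordinal (m_le : m < H.+1)%N).
  by rewrite /= m_gt0 => /negbT.
exfalso.
have H_gt0 : (0 < H)%N.
  rewrite lt0n; apply/eqP => H0; move: leXH; rewrite H0 leNgt => /negP[].
  by have := gt0_ltr_powR alpha_gt0 _ _ p_gt1R; rewrite powR1; apply; rewrite nnegrE.
(* This fixes the saving [eps] at [b / 2]. *)
have even_le q j : q \in ps -> (0 < j < q)%N ->
    `|free_sum w z H (j * (p.-1 %/ q)) [::]| <= b%:C - b%:C / 2.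
  case/psP=> q_pr q_dvd q_odd j_in.
  apply: (norm_even_sum_le p_pr w_prim z_prim sum_le) => //.
    exact: (nontrivial_twist w_prim).
  by apply: (dchar_even p_pr w_prim z_prim q_odd); rewrite -mulnA divnK // dvdn_mull.
have H_in : (0 < H < p)%N by rewrite H_gt0.
have := sieve_inequality p_pr w_prim z_prim ltHp
  (fun a => @norm_free_sum_nil_le _ _ w z _ sum_le a H H_in)
  (perm_mem esps) _ even_le noprim.
rewrite -(perm_uniq esps) primes_uniq -size_es -/s => /(_ isT).
have Ddelta : 1 - \sum_(q <- ps) q%:R^-1 = delta%:C.
  rewrite rmorphB rmorph1 rmorph_sum; congr (_ - _).
  by apply: eq_bigr => q _; rewrite fmorphV rmorph_nat.
rewrite /= Ddelta ltcR => /(_ delta_gt0) leC.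
have leR : delta * (H%:R - (2 ^+ (n - s) - 1) * b) <=
    (s%:R - 1 + delta) * (2 ^+ (n - s) * b - b / 2).
  clearbody b delta; rewrite -lecR !(rmorphM, rmorphB, rmorphD, rmorphXn) /=.
  by rewrite fmorphV !rmorph_nat.
move: X_gt; rewrite /Delta; set t := (_ - 1) / delta; set P := 2 ^+ _ in leR * => X_gt.
have t_ge0 : 0 <= t by apply: divr_ge0; [rewrite subr_ge0 ler1n | apply: ltW].
move: leR; have -> : s%:R - 1 + delta = delta * (t + 1).
  by rewrite /t; field; rewrite gt_eqF.
rewrite -mulrA ler_pM2l // => le_H.
(* [le_H] says [H <= b * (P * (t + 2) - 1) - (t + 1) * b / 2], where the last term is at least 1,
   while [X_gt] and [leXH] give [b * (P * (t + 2) - 1) < H + 1]. *)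
have : 2 <= (t + 1) * b by nra.
move: leXH; rewrite -natr1; lra.
Qed.
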